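(* Let $\mathbf{Y}=(Y,\mathcal{B}_Y,\nu,S)$ be an ergodic measure-preserving $\mathbb{Z}$-system, let $\alpha$ be a cocycle on $Y$, and let $\pi:\mathbf{X}_\alpha\to\mathbf{Y}$ be the projection onto the first coordinate. Let $L(n)=\log n$. Suppose that there exists a F\o lner sequence $(F_n)$ for $\mathbb{N}$ such that $h_{\mathrm{slow}}^{L,(F_n)}(\mathbf{X}_\alpha\,|\,\pi)=0$. Then $\mathbf{X}_\alpha$ is a rigid extension of $\mathbf{Y}$.
   Context: $\mathbf{Y}$ is a system consisting of a standard probability space and an invertible measure-preserving transformation $S$. $I$ is the unit interval with Lebesgue measure $m$, and $\operatorname{Aut}(I,m)$ is the group of measure-preserving automorphisms of $(I,m)$ modulo a.e. equality, with the weak topology: $\phi_n\to\phi$ iff $m(\phi_n^{-1}E\,\triangle\,\phi^{-1}E)\to0$ for all measurable $E\subseteq I$. A cocycle on $Y$ is a measurable map $\alpha:Y\to\operatorname{Aut}(I,m)$. It induces the skew product system $\mathbf{X}_\alpha=(Y\times I,\nu\times m,T_\alpha)$, $T_\alpha(y,t)=(Sy,\alpha(y)t)$. For $n\in\mathbb{N}$, $\alpha_n(y)=\alpha(S^{n-1}y)\circ\dots\circ\alpha(Sy)\circ\alpha(y)$. $\mathbf{X}_\alpha$ is a rigid extension of $\mathbf{Y}$ if for $\nu$-a.e. $y$ there is a sequence $n_1<n_2<\cdots$ (allowed to depend on $y$) such that $\alpha_{n_k}(y)\to\mathrm{id}$ as $k\to\infty$. A F\o lner sequence for $\mathbb{N}=\{0,1,2,\dots\}$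 is a sequence of finite nonempty sets $F_n\subseteq\mathbb{N}$ with $|(F_n+k)\cap F_n|/|F_n|\to1$ for every $k\in\mathbb{N}$ (so $|F_n|\to\infty$, and only the values of $L$ at large integers matter). Write $X=Y\times I$, $\mu=\nu\times m$, $T=T_\alpha$, and let $\mu_y=\delta_y\times m$ be the disintegration of $\mu$ over $\pi$. All partitions are finite and measurable; for $P=\{P_0,\dots,P_{r-1}\}$, $P(x)$ is the index $i$ with $x\in P_i$. For finite $F\subseteq\mathbb{N}$, $d_{P,F}(x,x')=\frac1{|F|}\sum_{f\in F}1_{P(T^fx)\ne P(T^fx')}$, with corresponding diameter $\operatorname{diam}_{P,F}$. For a probability measure $\lambda$ on $X$, $\operatorname{cov}(\lambda,P,F,\epsilon)$ is the smallest $M$ such that there exist $E_1,\dots,E_M\subseteq X$ with $\operatorname{diam}_{P,F}(E_i)\le\epsilon$ and $\lambda(\bigcup E_i)\ge1-\epsilon$; $$\operatorname{cov}(\mu,P,F,\epsilon\,|\,\pi)=\inf_{S'\subseteq Y:\ \nu(S')\ge1-\epsilon}\ \sup_{y\in S'}\operatorname{cov}(\mu_y,P,F,\epsilon),$$ $$h_{\mathrm{slow}}^{L,(F_n)}(\mathbf{X}_\alpha\,|\,\pi)=\sup_P\ \sup_{\epsilon>0}\ \limsup_{n\to\infty}\frac{\operatorname{cov}(\mu,P,F_n,\epsilon\,|\,\pi)}{L(|F_n|)},$$ the supremum being over all partitions $P$ of $X$. *)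

(* Defs.v *)
From HB Require Import structures.
From mathcomp Require Import all_boot all_order all_algebra finmap generic_quotient.
From mathcomp Require Import all_classical all_reals all_analysis.

Set Implicit Arguments.
Unset Strict Implicit.
Unset Printing Implicit Defensive.

Import Order.TTheory GRing.Theory Num.Theory.
Import numFieldNormedType.Exports.

Local Open Scope classical_set_scope.
Local Open Scope ring_scope.

Section measure_preserving_systems.
Context (R : realType).

(* [Y] is standard Borel: it is isomorphic, as a measurable space, to a Polish
   space with its Borel sets. A complete pseudometric space which is Hausdorff
   is a complete metric space. *)
Definition standard_borel d (Y : measurableType d) : Prop :=
  exists (M : completePseudoMetricType R) (f : Y -> M),
    [/\ hausdorff_space M,
        exists2 D : set M, countable D & dense D,
        bijective f
      & forall A : set M, <<s @open M >> A <-> measurable (f @^-1` A)].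

Definition measure_preserving d (X : measurableType d) (mu : set X -> \bar R)
    (f : X -> X) : Prop :=
  measurable_fun setT f /\
  forall A, measurable A -> mu (f @^-1` A) = mu A.

Definition invertible_mp d (X : measurableType d) (mu : set X -> \bar R)
    (f : X -> X) : Prop :=
  measure_preserving mu f /\
  exists g : X -> X, [/\ measurable_fun setT g, cancel f g & cancel g f].

Definition ergodic d (X : measurableType d) (mu : set X -> \bar R)
    (f : X -> X) : Prop :=
  forall A, measurable A -> f @^-1` A = A -> mu A = 0%E \/ mu A = 1%E.

End measure_preserving_systems.

Section unit_interval.
Context (R : realType).

Definition unit_set : set R := `[0, 1]%classic.

Let unit0 : (0 : R) \in unit_set.
Proof. by rewrite inE /unit_set /= in_itv /= lexx ler01. Qed.

HB.instance Definition _ := isPointed.Build unit_set (exist _ 0 unit0).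

(* Borel sigma-algebra: traces on [0, 1] of the Borel sets of R. *)
Definition I01 : Type :=
  g_sigma_algebra_preimageType (val : unit_set -> R).
HB.instance Definition _ := Measurable.on I01.

Definition I01val (t : I01) : R := val (t : unit_set).

Definition lebI (A : set I01) : \bar R := lebesgue_measure (I01val @` A).

Lemma I01val_inj : injective I01val. Proof. exact: val_inj. Qed.

Lemma measurable_I01val_image (A : set I01) :
  measurable A -> measurable (I01val @` A).
Proof.
move=> [B mB <-]; rewrite setTI.
rewrite (_ : _ @` _ = unit_set `&` B); last first.
  apply/seteqP; split => [_ [t Bt <-]|x [ux Bx]].
    by split; [exact: set_mem (valP (t : unit_set))|].
  by exists (exist _ x (mem_set ux)).
by apply: measurableI => //; exact: measurable_itv.
Qed.

Let lebI0 : lebI set0 = 0%E.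
Proof. by rewrite /lebI image_set0 measure0. Qed.

Let lebI_ge0 A : (0 <= lebI A)%E.
Proof. exact: measure_ge0. Qed.

Let lebI_sigma_additive : semi_sigma_additive lebI.
Proof.
move=> F mF tF mUF; rewrite /lebI image_bigcup.
apply: measure_semi_sigma_additive.
- by move=> i; exact: measurable_I01val_image.
- apply/trivIsetP => i j _ _ ij; apply/seteqP; split => // x.
  move=> [[s Fs <-] [t Ft /I01val_inj st]]; subst t.
  move/trivIsetP : tF => /(_ i j Logic.I Logic.I ij).
  by move/seteqP => [/(_ s)]; case.
- by rewrite -image_bigcup; exact: measurable_I01val_image.
Qed.

HB.instance Definition _ := isMeasure.Build _ _ _ lebI
  lebI0 lebI_ge0 lebI_sigma_additive.

Let lebI_setT : lebI setT = 1%E.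
Proof.
rewrite /lebI (_ : _ @` _ = unit_set); last first.
  apply/seteqP; split => [_ [t _ <-]|x ux].
    exact: set_mem (valP (t : unit_set)).
  by exists (exist _ x (mem_set ux)).
by rewrite lebesgue_measure_itv /= lte_fin ltr01 oppr0 adde0.
Qed.

HB.instance Definition _ := Measure_isProbability.Build _ _ _ lebI lebI_setT.

End unit_interval.

Section automorphisms.
Context (R : realType).
Local Notation I := (I01 R).
Local Notation m := (@lebI R).

(* A map representing an element of Aut(I, m): an a.e. inverse, itself measure
   preserving, is all that makes sense modulo a.e. equality. *)
Definition is_aut (f : I -> I) : Prop :=
  measure_preserving m f /\
  exists g : I -> I, [/\ measure_preserving m g,
    {ae m, forall t, g (f t) = t} & {ae m, forall t, f (g t) = t}].

Record aut_map := AutMap { aut_fun :> I -> I ; aut_funP : is_aut aut_fun }.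

HB.instance Definition _ := gen_eqMixin aut_map.
HB.instance Definition _ := gen_choiceMixin aut_map.

Definition aut_eq (f g : aut_map) : bool := `[< {ae m, forall t, f t = g t} >].

Lemma aut_eq_refl : reflexive aut_eq.
Proof. by move=> f; apply/asboolP; exact: nearW. Qed.

Lemma aut_eq_sym : symmetric aut_eq.
Proof.
by move=> f g; apply: asbool_equiv_eq; split; apply: filterS => t ->.
Qed.

Lemma aut_eq_trans : transitive aut_eq.
Proof.
move=> g f h /asboolP fg /asboolP gh; apply/asboolP.
by apply: filterS2 fg gh => t ->.
Qed.

Canonical aut_eq_equiv := EquivRel aut_eq aut_eq_refl aut_eq_sym aut_eq_trans.

Definition Aut := {eq_quot aut_eq}%qT.
HB.instance Definition _ := Choice.on Aut.
HB.instance Definition _ := EqQuotient.on Aut.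

Lemma is_aut_id : is_aut id.
Proof.
have h : measure_preserving m id by split => //; exact: measurable_id.
by split => //; exists id; split => //; exact: nearW.
Qed.

Lemma measure_preserving_comp (f g : I -> I) :
  measure_preserving m f -> measure_preserving m g ->
  measure_preserving m (f \o g).
Proof.
move=> [mf pf] [mg pg]; split; first exact: measurableT_comp.
move=> A mA; rewrite comp_preimage pg ?pf//.
by rewrite -[_ @^-1` _]setTI; exact: mf.
Qed.

Lemma measure_preserving_ae (f : I -> I) (P : I -> Prop) :
  measure_preserving m f -> {ae m, forall t, P t} -> {ae m, forall t, P (f t)}.
Proof.
move=> [mf pf] [N [mN N0 PN]]; exists (f @^-1` N); split.
- by rewrite -[_ @^-1` _]setTI; exact: mf.
- by rewrite pf.
- by move=> t /= Pt; exact: PN.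
Qed.

Lemma is_aut_comp (f g : I -> I) : is_aut f -> is_aut g -> is_aut (f \o g).
Proof.
move=> [pf [f' [pf' f'f ff']]] [pg [g' [pg' g'g gg']]].
split; first exact: measure_preserving_comp.
exists (g' \o f'); split; first exact: measure_preserving_comp.
- apply: filterS2 g'g (measure_preserving_ae pg f'f) => t /= + ht.
  by rewrite ht.
- apply: filterS2 ff' (measure_preserving_ae pf' gg') => t /= + ht.
  by rewrite ht.
Qed.

Definition aut_id : Aut := (\pi_Aut (AutMap is_aut_id))%qT.

Definition aut_comp (phi psi : Aut) : Aut :=
  (\pi_Aut (AutMap (is_aut_comp (aut_funP (repr phi)) (aut_funP (repr psi)))))%qT.

HB.instance Definition _ := isPointed.Build Aut aut_id.

(* m(phi^{-1} E /\ psi^{-1} E), /\ being the symmetric difference *)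
Definition aut_dist (E : set I) (phi psi : Aut) : \bar R :=
  m ((repr phi : aut_map) @^-1` E `+` (repr psi : aut_map) @^-1` E).

(* Weak topology: the coarsest one for which all the balls of the
   pseudometrics [aut_dist E], with E measurable, are open. *)
HB.instance Definition _ := @isSubBaseTopological.Build Aut
  (Aut * set I * R)%type
  [set p | measurable p.1.2 /\ 0 < p.2]
  (fun p => [set psi : Aut | (aut_dist p.1.2 p.1.1 psi < p.2%:E)%E]).

End automorphisms.

Section aut_topology_facts.
Context (R : realType).
Implicit Types (E : set (I01 R)) (phi psi chi : Aut R).

Lemma measurable_aut_preimage (f : aut_map R) E : measurable E -> measurable (f @^-1` E).
Proof.
move=> mE; have [[mf _] _] := aut_funP f.
by rewrite -[_ @^-1` _]setTI; exact: mf.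
Qed.

Lemma repr_aut_pi (f : aut_map R) :
  {ae @lebI R, forall t, repr (\pi_(Aut R) f)%qT t = f t}.
Proof.
by apply/asboolP; have /eqmodP := reprK (\pi_(Aut R) f)%qT.
Qed.

Lemma aut_comp_pi (f g : aut_map R) :
  (aut_comp (\pi_(Aut R) f) (\pi_(Aut R) g) =
   \pi_(Aut R) (AutMap (is_aut_comp (aut_funP f) (aut_funP g))))%qT.
Proof.
apply/eqmodP/asboolP => /=.
have [mpg _] := aut_funP (repr (\pi_(Aut R) g)%qT).
apply: filterS2 (repr_aut_pi g) (measure_preserving_ae mpg (repr_aut_pi f)).
by move=> t /= <-.
Qed.

Lemma aut_dist_pi E (f g : aut_map R) : measurable E ->
  aut_dist E (\pi_(Aut R) f)%qT (\pi_(Aut R) g)%qT =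
  lebI (f @^-1` E `+` g @^-1` E).
Proof.
move=> mE.
have mY (h k : aut_map R) : measurable (h @^-1` E `+` k @^-1` E).
  by apply: measurableU; apply: measurableD; exact: measurable_aut_preimage.
have le (A B : set (I01 R)) : measurable A -> measurable B ->
    {ae @lebI R, forall t, A t <-> B t} -> (lebI A <= lebI B)%E.
  move=> mA mB [N [mN N0 AB]]; rewrite -[leRHS]adde0 -N0.
  apply: le_trans (measureU2 _ mB mN).
  apply: le_measure; rewrite ?inE//; first exact: measurableU.
  move=> t At; have [Bt|nBt] := pselect (B t); first by left.
  by right; apply: AB => /= -[/(_ At)].
have ae : {ae @lebI R, forall t,
    (repr (\pi_(Aut R) f)%qT @^-1` E `+` repr (\pi_(Aut R) g)%qT @^-1` E) t <->
    (f @^-1` E `+` g @^-1` E) t}.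
  by apply: filterS2 (repr_aut_pi f) (repr_aut_pi g) => t /= -> ->.
apply/eqP; rewrite eq_le; apply/andP; split; apply: le => //.
by apply: filterS ae => t [].
Qed.

Lemma aut_dist_refl E phi : aut_dist E phi phi = 0%E.
Proof. by rewrite /aut_dist setYK measure0. Qed.

Lemma aut_dist_sym E phi psi : aut_dist E phi psi = aut_dist E psi phi.
Proof. by rewrite /aut_dist setYC. Qed.

Lemma aut_dist_triangle E phi psi chi : measurable E ->
  (aut_dist E phi chi <= aut_dist E phi psi + aut_dist E psi chi)%E.
Proof.
move=> mE; rewrite /aut_dist.
set A := repr phi @^-1` E; set B := repr psi @^-1` E.
set C := repr chi @^-1` E.
have [mA mB mC] : [/\ measurable A, measurable B & measurable C].
  by split; exact: measurable_aut_preimage.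
have mY (U V : set (I01 R)) :
    measurable U -> measurable V -> measurable (U `+` V).
  by move=> mU mV; apply: measurableU; exact: measurableD.
apply: le_trans (measureU2 _ (mY _ _ mA mB) (mY _ _ mB mC)).
apply: le_measure; rewrite ?inE.
- exact: mY.
- by apply: measurableU; exact: mY.
- move=> t /= [[At nCt]|[Ct nAt]]; have [Bt|nBt] := pselect (B t); tauto.
Qed.

(* Convergence in the topology of [Aut] is the convergence which defines the
   weak topology. *)
Lemma aut_cvgP (u : nat -> Aut R) phi :
  u @ \oo --> phi <->
  forall E, measurable E -> aut_dist E (u n) phi @[n --> \oo] --> 0%E.
Proof.
split=> [cu E mE|cu].
  have small (e : R) : 0 < e ->
      \forall n \near \oo, (aut_dist E (u n) phi < e%:E)%E.
    move=> e0.
    have : nbhs phi [set psi | (aut_dist E phi psi < e%:E)%E].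
      rewrite nbhsE; exists [set psi | (aut_dist E phi psi < e%:E)%E] => //.
      split; last by rewrite /= aut_dist_refl lte_fin.
      exists [set [set psi | (aut_dist E phi psi < e%:E)%E]].
        move=> _ ->; exists [fset (phi, E, e)]%fset.
          by move=> p; rewrite !inE => /eqP ->.
        by rewrite set_fset1 bigcap_set1.
      by rewrite bigcup_set1.
    move=> /cu; rewrite nbhs_filterE => -[N _ cuN]; exists N => // n Nn /=.
    by rewrite aut_dist_sym; exact: cuN.
  apply/fine_cvgP; split.
    apply: filterS (small 1 ltr01) => n h.
    by rewrite ge0_fin_numE ?measure_ge0// (lt_trans h)// ltry.
  apply/cvgrPdist_lt => e e0; apply: filterS (small e e0) => n h.
  have d0 : (0 <= aut_dist E (u n) phi)%E by exact: measure_ge0.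
  rewrite /= sub0r normrN ger0_norm ?fine_ge0// -lte_fin fineK//.
  by rewrite ge0_fin_numE// (lt_trans h)// ltry.
move=> A; rewrite nbhsE => -[_ [[B sB <-] [C BC Cphi]] sUBA].
rewrite nbhs_filterE; apply: filterS sUBA _; apply: (@filterS _ _ _ C).
  by move=> ? ?; exists C.
have /sB [D sD IDeC] := BC; rewrite -IDeC; apply: filter_bigI => -[[chi E] e] DE.
have := sD _ DE; rewrite inE => -[/= mE e0].
have dphi : (aut_dist E chi phi < e%:E)%E.
  by move: Cphi; rewrite -IDeC => /(_ _ DE).
have dfin : aut_dist E chi phi \is a fin_num.
  by rewrite ge0_fin_numE ?measure_ge0// (lt_trans dphi)// ltry.
have e'0 : 0 < e - fine (aut_dist E chi phi).
  by rewrite subr_gt0 -lte_fin fineK.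
have /fine_cvgP[ufin /cvgrPdist_lt/(_ _ e'0) ucv] := cu E mE.
apply: filterS2 ufin ucv => n nfin /=.
rewrite sub0r normrN ger0_norm ?fine_ge0 ?measure_ge0// => h.
apply: le_lt_trans (aut_dist_triangle _ phi _ mE) _.
rewrite [X in (_ + X)%E]aut_dist_sym -(fineK dfin) -(fineK nfin) lte_fin.
by rewrite addrC -ltrBrDr.
Qed.

End aut_topology_facts.

Section skew_products.
Context (R : realType) d (Y : measurableType d) (S : Y -> Y).
Local Notation I := (I01 R).

(* measurability with respect to the Borel sets of Aut(I, m) *)
Definition cocycle (alpha : Y -> Aut R) : Prop :=
  measurable_fun [set: Y]
    (alpha : Y -> g_sigma_algebraType (@open (Aut R))).

Fixpoint cocycle_iter (alpha : Y -> Aut R) (n : nat) (y : Y) : Aut R :=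
  if n is n'.+1 then aut_comp (alpha (iter n' S y)) (cocycle_iter alpha n' y)
  else aut_id R.

(* [T] is the transformation (y, t) |-> (S y, alpha(y) t). Since alpha(y) is
   an a.e. class, such a map is only determined up to a null set in each fibre:
   [T] uses some representative of each alpha(y), chosen so that [T] is
   measurable. *)
Definition skew_product (alpha : Y -> Aut R) (T : Y * I -> Y * I) : Prop :=
  measurable_fun setT T /\
  forall y, exists f : aut_map R,
    (\pi_(Aut R) f)%qT = alpha y /\ forall t, T (y, t) = (S y, f t).

Definition rigid_extension (nu : {measure set Y -> \bar R})
    (alpha : Y -> Aut R) : Prop :=
  {ae nu, forall y, exists n_ : nat -> nat,
    {homo n_ : i j / (i < j)%N} /\
    (fun k => cocycle_iter alpha (n_ k) y) @ \oo --> aut_id R}.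

End skew_products.

Definition folner (R : realType) (F : nat -> {fset nat}) : Prop :=
  (forall n, F n != fset0) /\
  forall k : nat,
    (#|` [fset (f + k)%N | f in F n] `&` F n|%fset%:R / #|` F n|%:R : R)
      @[n --> \oo] --> (1 : R).

Section relative_slow_entropy.
Context (R : realType) d (X : measurableType d) (T : X -> X).

(* A finite partition {P_0, ..., P_(r-1)} is given by its index map P. *)
Definition measurable_partition (r : nat) (P : X -> 'I_r) : Prop :=
  forall i, measurable (P @^-1` [set i]).

Definition hamming (r : nat) (P : X -> 'I_r) (F : {fset nat}) (x x' : X) : R :=
  (\sum_(f <- F) (P (iter f T x) != P (iter f T x'))%:R) / #|` F|%:R.

Definition hamming_diam (r : nat) (P : X -> 'I_r) (F : {fset nat})
    (E : set X) : \bar R :=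
  ereal_sup [set (hamming P F z.1 z.2)%:E | z in E `*` E].

Definition cov (lambda : set X -> \bar R) (r : nat) (P : X -> 'I_r)
    (F : {fset nat}) (eps : R) : \bar R :=
  ereal_inf [set M%:R%:E | M in [set M : nat |
    exists E : 'I_M -> set X,
      [/\ forall i, measurable (E i),
          forall i, (hamming_diam P F (E i) <= eps%:E)%E
        & ((1 - eps)%:E <= lambda (\bigcup_i E i))%E]]].

Context d' (Y : measurableType d') (nu : set Y -> \bar R)
  (mu_ : Y -> set X -> \bar R).

(* cov(mu, P, F, eps | pi), where [mu_] is the disintegration of mu over pi
   and nu is the image of mu *)
Definition rel_cov (r : nat) (P : X -> 'I_r) (F : {fset nat}) (eps : R)
    : \bar R :=
  ereal_inf [set ereal_sup [set cov (mu_ y) P F eps | y in S'] | S' in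
    [set S' : set Y | measurable S' /\ ((1 - eps)%:E <= nu S')%E]].

(* the -oo obtained from S' = set0 when eps >= 1 does not matter in the
   supremum below, because small eps contribute nonnegative terms *)
Definition rel_slow_entropy (L : nat -> R) (F : nat -> {fset nat}) : \bar R :=
  ereal_sup [set h | exists (r : nat) (P : X -> 'I_r) (eps : R),
    [/\ measurable_partition P, 0 < eps
      & h = limn_esup (fun n =>
              (rel_cov P (F n) eps / (L #|` F n|)%:E)%E)]].

End relative_slow_entropy.

Definition fibre_measure (R : realType) d (Y : measurableType d) (y : Y)
    : set (Y * I01 R) -> \bar R :=
  (\d_y \x @lebI R)%E.

Lemma fibre_measureE (R : realType) d (Y : measurableType d) (y : Y)
    (A : set (Y * I01 R)) :
  measurable A -> fibre_measure y A = lebI (xsection A y).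
Proof.
move=> mA; rewrite /fibre_measure /product_measure1 integral_dirac//.
  by rewrite diracT mul1e.
exact: measurable_fun_xsection.
Qed.

(* Main.v *)
Require Import Defs.
From mathcomp Require Import all_boot all_order all_algebra finmap.
From mathcomp Require Import all_classical all_reals all_analysis.
From mathcomp Require Import measurable_realfun.
From mathcomp Require Import zify ring lra.

Set Implicit Arguments.
Unset Strict Implicit.
Unset Printing Implicit Defensive.

Import Order.TTheory GRing.Theory Num.Theory.
Import numFieldNormedType.Exports.

Local Open Scope classical_set_scope.
Local Open Scope ring_scope.

(** Suppose that the fibre maps of [T] do not return close to the identity along
    the orbit of [y], for [y] in a set [A] of positive measure: some finite
    partition [Q] of the interval, some [delta > 0] and some [N] satisfy
    [m {t | Q (alpha_n(y) t) <> Q t} >= delta] for all [y] in [A] and [n >= N].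
    Look at the functions [Z_f t = Q (alpha_f(y) t)] at the times [f] of a large
    finite set [F] for which [S^f y] is in [A]. The cocycle identity
    [alpha_g(y) = alpha_(g-f)(S^f y) o alpha_f(y)] shows that [Z_f] and [Z_g]
    differ on a set of measure at least [delta] as soon as [g - f >= N]. On the
    other hand, a cover of most of the fibre by [M] sets of small Hamming
    diameter approximates most of the [Z_f] by functions which are constant on
    the [M] pieces, and there are only [r ^ M] of these. So the number of times
    in question, a fixed proportion of [|F|], is at most [N r ^ M] up to a small
    error, and [M] is at least a constant times [log |F|]
    ([separated_cover], [logarithmic_cover_bound]).

    The set of points [y] whose orbit visits [A] for a proportion at least
    [nu(A) / 2] of the times of [F] has measure at least [nu(A) / 2]
    ([frequent_visits]): this is an averaging argument which holds for every
    finite [F]. Hence the sets of measure [1 - eps] in the definition of the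
    relative covering number cannot avoid these points, and the slow entropy at
    scale [log] is positive as soon as [|F_n|] tends to infinity
    ([nonrecurrent_null]). The Folner condition forces this growth
    ([folner_card_gt]).

    Finally, countably many partitions [Q] are enough. The weak topology can be
    tested on rational rays ([aut_cvg_rat_rays]), so one uses the increasing
    sequence of partitions generated by the first [k] rays. For almost every
    [y], the union over [k] and [N] of the exceptional null sets is avoided, and
    return times [n_k] can be chosen one after the other
    ([recurrent_rigid]). *)

(** * Growth of Folner sequences and an averaging bound *)

(** Otherwise [F] would contain arbitrarily large integers. *)
Lemma fset_shift_nsub (F : {fset nat}) : F != fset0 ->
  ~~ (([fset (f + 1)%N | f in F] `<=` F)%fset).
Proof.
move=> /fset0Pn [f0 f0F]; apply/negP => /fsubsetP sub.
have all_shifts k : (f0 + k)%N \in F.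
  elim: k => [|k IH]; first by rewrite addn0.
  have -> : (f0 + k.+1 = f0 + k + 1)%N by lia.
  by apply: sub; apply/imfsetP; exists (f0 + k)%N.
(* The sum of the elements of [F] bounds each of them. *)
have : (f0 + (\sum_(f <- F) f).+1 <= \sum_(f <- F) f)%N.
  rewrite {2}(big_rem _ (all_shifts (\sum_(f <- F) f).+1)) /=.
  exact: leq_addr.
by lia.
Qed.

(** A translate [F + 1] is never contained in [F], so that the density of
    [(F + 1) & F] in [F] is at most [1 - 1 / |F|]. The Folner condition for the
    shift by [1] thus forces [1 / |F n|] to tend to [0]. *)
Lemma folner_card_gt (R : realType) (F : nat -> {fset nat}) (C : nat) :
  folner R F -> \forall n \near \oo, (C < #|` F n|)%N.
Proof.
move=> [F0 /(_ 1%N) /cvgrPdist_lt] /(_ C.+1%:R^-1) cF.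
have : 0 < C.+1%:R^-1 :> R by rewrite invr_gt0 ltr0n.
move=> /cF; apply: filterS => n.
set G := (_ `&` _)%fset => near1.
rewrite ltnNge; apply/negP => FC.
have Fpos : (0 < #|` F n|)%N by rewrite cardfs_gt0.
have GF : (#|` G| < #|` F n|)%N.
  apply: fproper_ltn_card; rewrite fproperE fsubsetIr /=.
  apply: contra (fset_shift_nsub (F0 n)) => FG.
  rewrite (_ : [fset _ | _ in _]%fset = G); first exact: fsubsetIr.
  apply/eqP; rewrite eq_sym eqEfcard fsubsetIl /=.
  apply: leq_trans (fsubset_leq_card FG).
  by rewrite card_imfset //= => i j /addIn.
have : 1 - #|` G|%:R / #|` F n|%:R < C.+1%:R^-1 :> R.
  exact: le_lt_trans (ler_norm _) near1.
apply/negP; rewrite -leNgt.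
have Fpos' : 0 < #|` F n|%:R :> R by rewrite ltr0n.
apply: (@le_trans _ _ (#|` F n|%:R^-1)).
  by rewrite lef_pV2 ?posrE ?ltr0n // ler_nat ltnW.
rewrite -[X in _ <= X - _](divff (lt0r_neq0 Fpos')) -mulrBl -[leLHS]mul1r.
rewrite ler_pM2r ?invr_gt0 // -natrB; last exact: ltnW.
by rewrite ler1n subn_gt0.
Qed.

(** Exchange of sum and integral: the left-hand side integrates the number of
    sets [D f] which contain [x]; this number is at most [k] on [G], and at most
    [size F] elsewhere. *)
Lemma sum_measure_le (R : realType) d (X : measurableType d)
    (mu : probability X R) (F : seq nat) (D : nat -> set X) (G : set X) (k : R) :
  (forall f, measurable (D f)) -> measurable G -> 0 <= k ->
  (forall x, G x -> \sum_(f <- F) \1_(D f) x <= k) ->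
  \sum_(f <- F) fine (mu (D f)) <= k + (size F)%:R * fine (mu (~` G)).
Proof.
move=> mD mG k0 Gk.
have mGC := measurableC mG.
have fin (A : set X) : measurable A -> mu A = (fine (mu A))%:E.
  by move=> mA; rewrite fineK // fin_num_measure.
have mI (A : set X) : measurable A ->
    measurable_fun [set: X] (EFin \o (\1_A : X -> R)).
  by move=> mA; apply/measurable_EFinP; exact: measurable_indic.
have sumE : (\sum_(f <- F) fine (mu (D f)))%:E =
    (\int[mu]_x (\sum_(f <- F) \1_(D f) x)%:E)%E.
  under eq_integral do rewrite -sumEFin.
  rewrite (@ge0_integral_sum _ _ _ mu _ _ _ (fun f x => (\1_(D f) x)%:E)) //;
    last first.
  - by move=> f; exact: mI.
  rewrite -sumEFin; apply: eq_bigr => f _.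
  by rewrite integral_indic // setIT -fin.
rewrite -lee_fin sumE EFinD EFinM -fin //.
have -> : (k%:E + (size F)%:R%:E * mu (~` G) =
    \int[mu]_x (k%:E + (size F)%:R%:E * (\1_(~` G) x)%:E))%E.
  rewrite ge0_integralD //; last first.
    by apply: measurable_funeM; exact: mI.
  have -> : (\int[mu]__ k%:E = k%:E)%E.
    by rewrite integral_cst // -[RHS]mule1; congr (_ * _)%E; exact: probability_setT.
  by rewrite ge0_integralZl //; [rewrite integral_indic // setIT|exact: mI].
apply: ge0_le_integral => //.
- by move=> x _; rewrite lee_fin sumr_ge0.
- under eq_fun do rewrite -sumEFin.
  by apply: emeasurable_sum => f; exact: mI.
- by apply: emeasurable_funD => //; apply: measurable_funeM; exact: mI.
move=> x _; rewrite -EFinM -EFinD lee_fin.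
have [Gx|nGx] := pselect (G x).
  by apply: le_trans (Gk x Gx) _; rewrite lerDl mulr_ge0.
rewrite [\1_(~` G) x]indicE mem_set // mulr1.
apply: (@le_trans _ _ (\sum_(f <- F) 1)).
  by apply: ler_sum => f _; rewrite indicE; case: (_ \in _).
by rewrite big_const_seq count_predT iter_addr addr0 lerDr.
Qed.

(** * Covers of separated families of finite-valued functions *)

Lemma measurable_neq_codes (r : nat) d (X : measurableType d)
    (Z W : X -> 'I_r) :
  measurable_partition Z -> measurable_partition W ->
  measurable [set x | Z x != W x].
Proof.
move=> mZ mW.
rewrite (_ : [set _ | _] =
    \bigcup_i (Z @^-1` [set i] `&` ~` (W @^-1` [set i]))).
  apply: fin_bigcup_measurable => // i _.
  by apply: measurableI => //; exact: measurableC.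
apply/seteqP; split => [x /= /eqP ZW|x [i _ [/= <- /eqP WZ]]].
  by exists (Z x) => //; split => //= WZ; exact: ZW.
by rewrite /= eq_sym.
Qed.

(** A cover by [M] sets [E i] on which the names [f |-> Z f x] stay [eps]-close
    to a fixed word [w i] approximates [Z f], for most [f], by the function which
    takes the value [w i f] on the piece [E i]. Two functions [Z f] and [Z g]
    with the same approximation are close in measure, hence cannot be separated;
    so the approximation, together with the residue of [f] modulo [N + 1] which
    excludes pairs of distinct times at distance at most [N], determines [f].
    The last term counts the times for which the approximation is poor. *)
Lemma separated_cover (R : realType) d (X : measurableType d)
    (mu : probability X R) (r M N : nat) (Z : nat -> X -> 'I_r)
    (F : {fset nat}) (H : pred nat) (E : 'I_M -> set X)
    (w : 'I_M -> nat -> 'I_r) (eps delta : R) :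
  (forall f, measurable_partition (Z f)) ->
  (forall i, measurable (E i)) ->
  0 <= eps -> 0 < delta ->
  (forall i x, E i x ->
    \sum_(f <- F) (Z f x != w i f)%:R <= eps * #|` F|%:R) ->
  1 - eps <= fine (mu (\bigcup_i E i)) ->
  {in H &, forall f g, (f + N < g)%N ->
    delta <= fine (mu [set x | Z f x != Z g x])} ->
  (count H F)%:R <= (N.+1 * r ^ M)%:R + 4 * eps / delta * #|` F|%:R.
Proof.
move=> mZ mE eps0 delta0 EF EU sep.
(* Disjoint pieces, so that the approximating function is single-valued. *)
pose E' i := E i `\` \bigcup_(j in [set j : 'I_M | (j < i)%N]) E j.
have mE' i : measurable (E' i).
  by apply: measurableD => //; exact: fin_bigcup_measurable.
have E'E i : E' i `<=` E i by move=> x [].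
have E'I i j x : E' i x -> E' j x -> i = j.
  move=> [Ei nEi] [Ej nEj]; case: (ltngtP i j) => [ij|ji|/val_inj //].
    by case: nEj; exists i.
  by case: nEi; exists j.
have E'U x : (\bigcup_i E i) x -> exists i, E' i x.
  move=> [i0 _ /asboolP Ex].
  pose P (i : 'I_M) := `[< E i x >].
  have [i /asboolP Eix imin] := @arg_minnP _ i0 P (@nat_of_ord M) Ex.
  exists i; split => // -[j /= ji /asboolP /imin].
  by rewrite leqNgt ji.
(* The points where [Z f] disagrees with its approximation; those which lie
   outside of the cover are included. *)
pose D f := ~` \bigcup_i (E' i `&` Z f @^-1` [set w i f]).
have mD f : measurable (D f).
  apply: measurableC; apply: fin_bigcup_measurable => // i _.
  by apply: measurableI => //; exact: mZ.
have mU : measurable (\bigcup_i E i) by exact: fin_bigcup_measurable.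
have fin (A : set X) : measurable A -> mu A = (fine (mu A))%:E.
  by move=> mA; rewrite fineK // fin_num_measure.
have UC : fine (mu (~` \bigcup_i E i)) <= eps.
  have -> : fine (mu (~` \bigcup_i E i)) = 1 - fine (mu (\bigcup_i E i)).
    by rewrite probability_setC // fineB ?fin_num_measure.
  by rewrite lerBlDr -lerBlDl.
have Fpos : 0 <= #|` F|%:R :> R by [].
have sumD : \sum_(f <- F) fine (mu (D f)) <= 2 * eps * #|` F|%:R.
  apply: le_trans (@sum_measure_le _ _ _ mu F D (\bigcup_i E i)
    (eps * #|` F|%:R) mD mU (mulr_ge0 eps0 Fpos) _) _.
    move=> x /E'U [i E'ix]; apply: le_trans (EF i x (E'E i x E'ix)).
    apply: ler_sum => f _; rewrite indicE.
    have [Zw|//] := eqVneq (Z f x) (w i f); last by case: (_ \in _).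
    rewrite memNset //= => Dx; apply: Dx; by exists i.
  rewrite -mulrA [2 * _]mulrC mulrDr mulr1 lerD2l [leRHS]mulrC.
  by rewrite ler_wpM2l.
(* If neither [f] nor [g] is bad, the two errors add up to less than [delta]. *)
pose bad f := delta / 2 <= fine (mu (D f)).
have cbad : (count bad F)%:R <= 4 * eps / delta * #|` F|%:R.
  have : delta / 2 * (count bad F)%:R <= 2 * eps * #|` F|%:R.
    apply: le_trans sumD; rewrite -sum1_count natr_sum mulr_sumr big_mkcond /=.
    apply: ler_sum => f _; case: ifP => [|_]; first by rewrite mulr1.
    by rewrite fine_ge0 ?measure_ge0.
  move=> le; rewrite -(ler_pM2l (divr_gt0 delta0 (ltr0n _ 2))).
  apply: le_trans le _; rewrite le_eqVlt; apply/orP; left; apply/eqP.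
  by field; apply: lt0r_neq0.
pose H' f := H f && ~~ bad f.
have cH : (count H F <= count H' F + count bad F)%N.
  rewrite -(count_predUI H' bad) -[leqLHS]addn0 leq_add // sub_count // => f /= Hf.
  by rewrite /H' Hf /=; case: (bad f).
pose code f : {ffun 'I_M -> 'I_r} * 'I_N.+1 :=
  ([ffun i => w i f], inord (f %% N.+1)).
have code_inj : {in [seq f <- F | H' f] &, injective code}.
  have key f g : H' f -> H' g -> code f = code g -> ~ (f < g)%N.
    move=> /andP [Hf]; rewrite /bad -ltNge => Df /andP [Hg].
    rewrite /bad -ltNge => Dg [/ffunP wE].
    move/(congr1 val); rewrite /= !inordK ?ltn_mod // => fgN fg.
    have := sep f g Hf Hg.
    have -> : (f + N < g)%N.
      move/eqP: fgN; rewrite eq_sym eqn_mod_dvd ?(ltnW fg) // => /dvdn_leq.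
      by rewrite subn_gt0 fg => /(_ isT); lia.
    move=> /(_ isT); apply/negP; rewrite -ltNge.
    have mfg := measurable_neq_codes (mZ f) (mZ g).
    suff : fine (mu [set x | Z f x != Z g x]) <= fine (mu (D f)) + fine (mu (D g)).
      by move=> le; lra.
    rewrite -lee_fin EFinD -!fin //.
    apply: le_trans (measureU2 _ (mD f) (mD g)).
    apply: le_measure; rewrite ?inE //; first exact: measurableU.
    move=> x /= /eqP Zfg; apply: contrapT => /not_orP [].
    rewrite /D /= !notK => -[i _ [E'i Zi]] [j _ [E'j Zj]].
    apply: Zfg; rewrite Zi Zj (E'I _ _ _ E'i E'j).
    by have := wE j; rewrite !ffunE.
  move=> f g; rewrite !mem_filter => /andP [Hf _] /andP [Hg _] fg.
  by case: (ltngtP f g) => // lt; [case: (key f g)|case: (key g f)].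
have cH' : (count H' F <= N.+1 * r ^ M)%N.
  rewrite -size_filter -(size_map code).
  have un : uniq (map code [seq f <- F | H' f]).
    by rewrite map_inj_in_uniq // filter_uniq // fset_uniq.
  rewrite -(card_uniqP un); apply: leq_trans (max_card _) _.
  by rewrite card_prod card_ffun !card_ord mulnC.
apply: le_trans (_ : (count H' F + count bad F)%:R <= _).
  by rewrite ler_nat.
by rewrite natrD lerD // ler_nat.
Qed.

(** * Iterates of skew products and countable tests for weak convergence *)

(** The iterates of [T] are genuine maps whereas [cocycle_iter] is a product of
    classes modulo null sets: [iter n T] provides representatives which are
    jointly measurable in the two coordinates. *)
Lemma skew_product_iter (R : realType) d (Y : measurableType d) (S : Y -> Y)
    (alpha : Y -> Aut R) (T : Y * I01 R -> Y * I01 R) (n : nat) (y : Y) :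
  skew_product S alpha T ->
  exists f : aut_map R, (\pi_(Aut R) f)%qT = cocycle_iter S alpha n y /\
    forall t, iter n T (y, t) = (iter n S y, f t).
Proof.
move=> [_ skew]; elim: n => [|n [f [fC fE]] /=].
  by exists (AutMap (@is_aut_id R)).
have [g [gE gT]] := skew (iter n S y).
exists (AutMap (is_aut_comp (aut_funP g) (aut_funP f))).
by split => [|t]; rewrite -?gE -?fC ?aut_comp_pi ?fE ?gT.
Qed.

Lemma measurable_iter d (X : measurableType d) (T : X -> X) (n : nat) :
  measurable_fun setT T -> measurable_fun setT (iter n T).
Proof.
move=> mT; elim: n => [|n IH]; first exact: measurable_id.
exact: (measurableT_comp mT IH).
Qed.

(** The default value [0] is harmless: indices which code no rational only repeat
    the ray at [0]. *)
Definition rat_ray (R : realType) (i : nat) : set (I01 R) :=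
  fun t => ratr (odflt 0 (@choice.unpickle rat i)) < I01val t.

(** The index map of the partition generated by the first [k] rational rays.
    These partitions become finer as [k] grows. *)
Definition ray_code (R : realType) (k : nat) (t : I01 R) :
    'I_#|{: {ffun 'I_k -> bool}}| :=
  enum_rank [ffun i : 'I_k => `[< @rat_ray R i t >]].

Lemma measurable_I01val (R : realType) (B : set R) :
  measurable B -> measurable (@I01val R @^-1` B).
Proof. by move=> mB; exists B => //; rewrite setTI. Qed.

Lemma measurable_rat_ray (R : realType) (i : nat) : measurable (@rat_ray R i).
Proof.
pose q : R := ratr (odflt 0 (@choice.unpickle rat i)).
have -> : @rat_ray R i = @I01val R @^-1` `]q, +oo[.
  by apply/seteqP; split => t /=; rewrite in_itv /= andbT.
by apply: measurable_I01val; exact: measurable_itv.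
Qed.

Lemma measurable_ray_code (R : realType) (k : nat) :
  measurable_partition (@ray_code R k).
Proof.
move=> a.
rewrite (_ : _ @^-1` _ = \bigcap_(i : 'I_k)
  (if enum_val a i then rat_ray i else ~` rat_ray i)).
  apply: fin_bigcap_measurable => // i _.
  by case: (enum_val a i); [|apply: measurableC]; exact: measurable_rat_ray.
apply/seteqP; split => [t /= <- i _|t /= tE].
  by rewrite enum_rankK ffunE; case: asboolP.
apply: (canLR enum_valK); apply/ffunP => i; rewrite ffunE.
by have := tE i Logic.I; case: (enum_val a i) => [/asboolT|/asboolF].
Qed.

Lemma ray_code_neq (R : realType) (i k : nat) (s t : I01 R) :
  (i < k)%N -> (rat_ray i s /\ ~ rat_ray i t) \/ (rat_ray i t /\ ~ rat_ray i s) ->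
  ray_code k s != ray_code k t.
Proof.
move=> ik sep; apply/eqP => /enum_rank_inj /ffunP /(_ (Ordinal ik)).
rewrite !ffunE /=; case: sep => -[Es nEt].
  by rewrite (asboolT Es) (asboolF nEt).
by rewrite (asboolT Es) (asboolF nEt).
Qed.

Lemma measurable_setY d (X : measurableType d) (A B : set X) :
  measurable A -> measurable B -> measurable (A `+` B).
Proof. by move=> mA mB; apply: measurableU; exact: measurableD. Qed.

Lemma aut_dist_setC (R : realType) (A : set (I01 R)) (phi psi : Aut R) :
  aut_dist (~` A) phi psi = aut_dist A phi psi.
Proof.
rewrite /aut_dist; congr (lebI _); apply/seteqP; rewrite /setY /setD /setC.
by split => t /=; have [?|?] := pselect (A (repr phi t));
  have [?|?] := pselect (A (repr psi t)); tauto.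
Qed.

(** The symmetric difference of two unions is contained in the union of the
    symmetric differences. *)
Lemma aut_dist_setUl (R : realType) (A B : set (I01 R)) (phi psi : Aut R) :
  measurable A -> measurable B ->
  (aut_dist (A `|` B) phi psi <= aut_dist A phi psi + aut_dist B phi psi)%E.
Proof.
move=> mA mB; have mf (f : aut_map R) := @measurable_aut_preimage R f.
rewrite /aut_dist.
apply: (@le_trans _ _ (lebI ((repr phi @^-1` A `+` repr psi @^-1` A)
  `|` (repr phi @^-1` B `+` repr psi @^-1` B)))); last first.
  by apply: measureU2; apply: measurable_setY; exact: mf.
apply: le_measure; rewrite ?inE.
- by apply: measurable_setY; apply: mf; exact: measurableU.
- by apply: measurableU; apply: measurable_setY; exact: mf.
by move=> t; rewrite /setY /setD /setU /=; tauto.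
Qed.

(** Uniform in [phi] and [psi], because both preserve the measure: sets of small
    measure contribute little whatever the automorphisms are. *)
Lemma aut_dist_le (R : realType) (A : set (I01 R)) (phi psi : Aut R) :
  measurable A -> (aut_dist A phi psi <= lebI A + lebI A)%E.
Proof.
move=> mA; have mf (f : aut_map R) := @measurable_aut_preimage R f _ mA.
have mpE (f : aut_map R) : lebI (f @^-1` A) = lebI A.
  by have [[_ ->]] := aut_funP f.
rewrite -{1}(mpE (repr phi)) -(mpE (repr psi)).
apply: le_trans (measureU2 _ (mf _) (mf _)).
apply: le_measure; rewrite ?inE.
- exact: measurable_setY.
- by apply: measurableU; exact: mf.
by move=> t; rewrite /setY /setD /setU /=; tauto.
Qed.

(** The sets [A] for which [aut_dist A (u n) phi] tends to [0] form a
    sigma-algebra. For countable unions, the tail of the union has small measure,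
    hence a small contribution uniformly in [n]. The rational rays generate the
    Borel sets. *)
Lemma aut_cvg_rat_rays (R : realType) (u : nat -> Aut R) (phi : Aut R) :
  (forall i, aut_dist (@rat_ray R i) (u n) phi @[n --> \oo] --> 0%E) ->
  u @ \oo --> phi.
Proof.
move=> ray_cvg; apply/aut_cvgP.
pose small A := forall e : R, 0 < e ->
  \forall n \near \oo, (aut_dist A (u n) phi < e%:E)%E.
pose C := [set A : set (I01 R) | measurable A /\ small A].
have smallP A : small A -> aut_dist A (u n) phi @[n --> \oo] --> 0%E.
  move=> sA; apply/fine_cvgP; split.
    apply: filterS (sA 1 ltr01) => n h.
    by rewrite ge0_fin_numE ?measure_ge0// (lt_trans h)// ltry.
  apply/cvgrPdist_lt => e e0; apply: filterS (sA e e0) => n h.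
  have d0 : (0 <= aut_dist A (u n) phi)%E by exact: measure_ge0.
  rewrite /= sub0r normrN ger0_norm ?fine_ge0// -lte_fin fineK//.
  by rewrite ge0_fin_numE// (lt_trans h)// ltry.
have C_ray i : C (rat_ray i).
  split => [|e e0]; first exact: measurable_rat_ray.
  have /fine_cvgP[ufin /cvgrPdist_lt/(_ _ e0) ucv] := ray_cvg i.
  apply: filterS2 ufin ucv => n nfin /=.
  rewrite sub0r normrN ger0_norm ?fine_ge0 ?measure_ge0// => h.
  by rewrite -(fineK nfin) lte_fin.
have C0 : C set0.
  split => // e e0; apply: nearW => n.
  by rewrite /aut_dist !preimage_set0 setYK measure0 lte_fin.
have CC A : C A -> C (~` A).
  move=> [mA sA]; split; first exact: measurableC.
  by move=> e e0; apply: filterS (sA e e0) => n; rewrite aut_dist_setC.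
have CU A B : C A -> C B -> C (A `|` B).
  move=> [mA sA] [mB sB]; split; first exact: measurableU.
  move=> e e0; have e2 : 0 < e / 2 by lra.
  apply: filterS2 (sA _ e2) (sB _ e2) => n An Bn.
  apply: le_lt_trans (aut_dist_setUl _ _ mA mB) _.
  by rewrite (splitr e) EFinD lteD.
have CUn (A : (set (I01 R))^nat) : (forall n, C (A n)) -> C (\bigcup_n A n).
  move=> CA; have mU : measurable (\bigcup_n A n).
    by apply: bigcupT_measurable => n; exact: (CA n).1.
  pose B k := \bigcup_(n < k) A n.
  have CB k : C (B k).
    elim: k => [|k IH]; first by rewrite /B bigcup_mkord big_ord0.
    by rewrite /B bigcup_mkord big_ord_recr /= -bigcup_mkord; exact: CU.
  have mR k : measurable (\bigcup_n A n `\` B k).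
    by apply: measurableD => //; exact: (CB k).1.
  split => // e e0; have e4 : 0 < e / 4 by lra.
  have tail_cvg : lebI (\bigcup_n A n `\` B k) @[k --> \oo] --> 0%E.
    have := @nonincreasing_cvg_mu _ _ _ (@lebI R) (fun k => \bigcup_n A n `\` B k).
    have -> : \bigcap_k (\bigcup_n A n `\` B k) = set0.
      apply/seteqP; split => // t tE; have [[n _ At] _] := tE 0%N Logic.I.
      by have [_] := tE n.+1 Logic.I; apply; exists n => //=.
    rewrite measure0; apply => //.
    - by apply: (@le_lt_trans _ _ 1%E); [exact: probability_le1|rewrite ltry].
    - move=> j k jk; apply/subsetPset => t [Ut nB]; split => // -[n /= nj At].
      by apply: nB; exists n => //=; exact: leq_trans jk.
  have [k tailk] : exists k, (lebI (\bigcup_n A n `\` B k) < (e / 4)%:E)%E.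
    have /fine_cvgP[ufin /cvgrPdist_lt/(_ _ e4) ucv] := tail_cvg.
    have [k _ /(_ k (leqnn k)) []] := filterI ufin ucv.
    move=> kfin /=.
    rewrite sub0r normrN ger0_norm ?fine_ge0 ?measure_ge0// => h.
    by exists k; rewrite -(fineK kfin) lte_fin.
  have e2 : 0 < e / 2 by lra.
  apply: filterS ((CB k).2 _ e2) => n Bn.
  have -> : \bigcup_n A n = B k `|` (\bigcup_n A n `\` B k).
    apply/seteqP; split => [t Ut|t [[j _ At]|[]//]]; last by exists j.
    by have [|] := pselect (B k t); [left|right].
  apply: le_lt_trans (aut_dist_setUl _ _ (CB k).1 (mR k)) _.
  rewrite (splitr e) EFinD lteD //.
  apply: le_lt_trans (aut_dist_le _ _ (mR k)) _.
  by rewrite (_ : e / 2 = e / 4 + e / 4); [rewrite EFinD lteD|lra].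
pose CR := [set A : set R | C (@I01val R @^-1` A)].
have sCR : sigma_algebra setT CR.
  split.
  - by rewrite /CR /= preimage_set0.
  - by move=> A CA; rewrite /CR /= setTD preimage_setC; exact: CC.
  - by move=> A CA; rewrite /CR /= preimage_bigcup; exact: CUn.
have rayCR : @RGenOInfty.G R `<=` CR.
  move=> _ [x ->]; rewrite /CR /=.
  pose D i : set (I01 R) :=
    if x < ratr (odflt 0 (@choice.unpickle rat i)) then rat_ray i else set0.
  rewrite (_ : _ @^-1` _ = \bigcup_i D i); last first.
    apply/seteqP; split => t /=; rewrite in_itv /= andbT.
      move=> /rat_in_itvoo [q]; rewrite in_itv /= => /andP [xq qt].
      by exists (choice.pickle q) => //; rewrite /D /rat_ray choice.pickleK /= xq.
    move=> [i _]; rewrite /D /rat_ray; case: ifP => //= xq; exact: lt_trans.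
  by apply: CUn => i; rewrite /D; case: ifP.
move=> E [B mB]; rewrite setTI => <-; apply: smallP.
suff : CR B by case.
move: mB; rewrite /measurable /= => mB.
have : (@RGenOInfty.G R).-sigma.-measurable B by rewrite -RGenOInfty.measurableE.
exact: smallest_sub.
Qed.

(** * Logarithmic lower bounds for covers of the fibres *)

(** How far [alpha_n(y)] is from the identity, measured on the partition
    [ray_code k]. *)
Definition drift (R : realType) d (Y : measurableType d)
    (T : Y * I01 R -> Y * I01 R) (k n : nat) (y : Y) : \bar R :=
  lebI [set t | ray_code k (iter n T (y, t)).2 != ray_code k t].

(** The points [y] whose fibre maps stay away from the identity from time [N]
    on, at the scale given by [k]. Rigidity holds at every point which belongs to
    none of these sets. *)
Definition nonrecurrent (R : realType) d (Y : measurableType d)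
    (T : Y * I01 R -> Y * I01 R) (k N : nat) : set Y :=
  [set y | forall n, (N <= n)%N -> (k.+1%:R^-1%:E <= drift T k n y)%E].

Lemma measurable_partition_comp d1 d2 (X1 : measurableType d1)
    (X2 : measurableType d2) (h : X1 -> X2) (r : nat) (P : X2 -> 'I_r) :
  measurable_fun setT h -> measurable_partition P ->
  measurable_partition (P \o h).
Proof.
by move=> mh mP i; rewrite comp_preimage -[X in measurable X]setTI; exact: mh.
Qed.

Lemma measurable_iter_code (R : realType) d (Y : measurableType d)
    (T : Y * I01 R -> Y * I01 R) (k n : nat) :
  measurable_fun setT T ->
  measurable_partition (fun z => ray_code k (iter n T z).2).
Proof.
move=> mT; apply: (@measurable_partition_comp _ _ _ _ (snd \o iter n T)).
  by apply: measurableT_comp => //; exact: measurable_iter.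
exact: measurable_ray_code.
Qed.

Lemma measurable_partition_fibre (R : realType) d (Y : measurableType d) (y : Y)
    (r : nat) (P : Y * I01 R -> 'I_r) :
  measurable_partition P -> measurable_partition (fun t => P (y, t)).
Proof.
move=> mP i; have := measurable_xsection y (mP i).
congr measurable; apply/seteqP.
by split => t; rewrite /xsection /= inE.
Qed.

Lemma measurable_drift_set (R : realType) d (Y : measurableType d)
    (T : Y * I01 R -> Y * I01 R) (k n : nat) (y : Y) :
  measurable_fun setT T ->
  measurable [set t | ray_code k (iter n T (y, t)).2 != ray_code k t].
Proof.
move=> mT; apply: (@measurable_neq_codes _ _ _
  (fun t => ray_code k (iter n T (y, t)).2)); last exact: measurable_ray_code.
exact: (measurable_partition_fibre y (@measurable_iter_code _ _ _ _ k n mT)).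
Qed.

(** By Fubini: [drift T k n] is the measure of the fibres of a measurable subset
    of the product. *)
Lemma measurable_nonrecurrent (R : realType) d (Y : measurableType d)
    (T : Y * I01 R -> Y * I01 R) (k N : nat) :
  measurable_fun setT T -> measurable (nonrecurrent T k N).
Proof.
move=> mT.
have mdrift n : measurable_fun [set: Y] (drift T k n).
  have mE := measurable_neq_codes (@measurable_iter_code _ _ _ _ k n mT)
    (@measurable_iter_code _ _ _ _ k 0 mT).
  have := measurable_fun_xsection (@lebI R) mE.
  congr measurable_fun; apply/funext => y; rewrite /drift /=; congr (lebI _).
  by apply/seteqP; split => t; rewrite /xsection /= inE.
rewrite (_ : nonrecurrent T k N =
    \bigcap_(n in [set n | (N <= n)%N])
      [set y | (k.+1%:R^-1%:E <= drift T k n y)%E]) //.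
apply: bigcap_measurableType => n _.
rewrite -[X in measurable X]setTI.
exact: emeasurable_fun_c_infty.
Qed.

(** The cocycle identity: the maps at times [f] and [g] along the orbit of [y]
    differ as much as the map at time [g - f] from the point [S^f y] differs from
    the identity, because the map at time [f] preserves the measure. *)
Lemma drift_shift (R : realType) d (Y : measurableType d) (S : Y -> Y)
    (alpha : Y -> Aut R) (T : Y * I01 R -> Y * I01 R) (k f g : nat) (y : Y) :
  skew_product S alpha T -> (f <= g)%N ->
  lebI [set t | ray_code k (iter f T (y, t)).2 != ray_code k (iter g T (y, t)).2]
  = drift T k (g - f) (iter f S y).
Proof.
move=> skew fg; have [phi [_ phiE]] := skew_product_iter f y skew.
have [[_ mp] _] := aut_funP phi.
rewrite /drift -[RHS]mp.
  have gE t : iter g T (y, t) = iter (g - f) T (iter f S y, phi t).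
    by rewrite -phiE -iterD subnK.
  by congr (lebI _); apply/funext => t /=; rewrite gE phiE eq_sym.
exact: measurable_drift_set skew.1.
Qed.

(** For [i < k], the [i]-th ray is a union of pieces of the partition
    [ray_code k]. *)
Lemma aut_dist_rat_ray_le_drift (R : realType) d (Y : measurableType d)
    (S : Y -> Y) (alpha : Y -> Aut R) (T : Y * I01 R -> Y * I01 R)
    (i k n : nat) (y : Y) :
  skew_product S alpha T -> (i < k)%N ->
  (aut_dist (@rat_ray R i) (cocycle_iter S alpha n y) (aut_id R) <=
   drift T k n y)%E.
Proof.
move=> skew ik; have [phi [<- phiE]] := skew_product_iter n y skew.
have mray := @measurable_rat_ray R i.
rewrite aut_dist_pi //; apply: le_measure; rewrite ?inE.
- by apply: measurable_setY => //; exact: measurable_aut_preimage.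
- exact: measurable_drift_set skew.1.
by move=> t /= tE; rewrite phiE /=; apply: (ray_code_neq ik).
Qed.

(** The words required by [separated_cover] are the names of arbitrary points of
    the pieces [E i]. Those points may lie in other fibres: the diameter bound
    compares them with all points of [E i]. *)
Lemma fibre_cover_lower_bound (R : realType) d (Y : measurableType d)
    (S : Y -> Y) (alpha : Y -> Aut R) (T : Y * I01 R -> Y * I01 R)
    (k N M : nat) (y : Y) (F : {fset nat}) (eps : R)
    (E : 'I_M -> set (Y * I01 R)) :
  skew_product S alpha T -> F != fset0 -> 0 <= eps ->
  (forall i, measurable (E i)) ->
  (forall i, (hamming_diam R T (fun z => ray_code k z.2) F (E i) <= eps%:E)%E) ->
  ((1 - eps)%:E <= fibre_measure y (\bigcup_i E i))%E ->
  (count (fun f => `[< nonrecurrent T k N (iter f S y) >]) F)%:R <=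
  (N.+1 * #|{: {ffun 'I_k -> bool}}| ^ M)%:R + 4 * eps / k.+1%:R^-1 * #|` F|%:R.
Proof.
move=> skew F0 eps0 mE Ediam EU; have mT := skew.1.
have Fpos : 0 < #|` F|%:R :> R by rewrite ltr0n cardfs_gt0.
have centers i : exists w : nat -> 'I_#|{: {ffun 'I_k -> bool}}|,
    forall z, E i z ->
    \sum_(f <- F) (ray_code k (iter f T z).2 != w f)%:R <= eps * #|` F|%:R.
  have [[z0 Ez0]|nE] := pselect (exists z, E i z); last first.
    by exists (fun=> enum_rank [ffun=> true]) => z Ez; case: nE; exists z.
  exists (fun f => ray_code k (iter f T z0).2) => z Ez.
  rewrite -ler_pdivrMr // -lee_fin; apply: le_trans (Ediam i).
  by apply: ereal_sup_ubound; exists (z, z0).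
have [w wE] := choice centers.
apply: (@separated_cover _ _ _ (@lebI R) _ M N
  (fun f t => ray_code k (iter f T (y, t)).2) F _ (fun i => xsection (E i) y) w).
- move=> f.
  exact: (measurable_partition_fibre y (@measurable_iter_code _ _ _ _ k f mT)).
- by move=> i; exact: measurable_xsection.
- exact: eps0.
- by rewrite invr_gt0 ltr0n.
- by move=> i t; rewrite /xsection /= inE => Eyt; exact: wE.
- have mU : measurable (\bigcup_i E i) by exact: fin_bigcup_measurable.
  have mX := measurable_xsection y mU.
  have -> : \bigcup_i xsection (E i) y = xsection (\bigcup_i E i) y.
    apply/seteqP; rewrite /xsection; split => t /=.
      by move=> [i _ /set_mem Ei]; apply/mem_set; exists i.
    by move=> /set_mem [i _ Ei]; exists i => //; apply/mem_set.
  rewrite -lee_fin fineK; last exact: fin_num_measure.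
  by move: EU; rewrite fibre_measureE.
- move=> f g /asboolP Af _ fg; rewrite -lee_fin fineK; last first.
    apply: fin_num_measure; apply: measurable_neq_codes.
      exact: (measurable_partition_fibre y (@measurable_iter_code _ _ _ _ k f mT)).
    exact: (measurable_partition_fibre y (@measurable_iter_code _ _ _ _ k g mT)).
  have fg' : (f <= g)%N by lia.
  have gfN : (N <= g - f)%N by lia.
  by have := Af _ gfN; rewrite -(drift_shift k y skew fg').
Qed.

(** Markov's inequality for the proportion of the times [f] in [F] with [S^f y]
    in [A]: its mean is the measure of [A] since [S] is measure preserving. *)
Lemma frequent_visits (R : realType) d (Y : measurableType d)
    (nu : probability Y R) (S : Y -> Y) (A : set Y) (F : {fset nat}) (a : R) :
  measure_preserving nu S -> measurable A -> F != fset0 -> 0 <= a ->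
  a <= fine (nu A) ->
  exists B : set Y, [/\ measurable B, a / 2 <= fine (nu B) &
    forall y, B y ->
      a / 2 * #|` F|%:R <= (count (fun f => `[< A (iter f S y) >]) F)%:R].
Proof.
move=> [mS pS] mA F0 a0 aA.
have Fpos : 0 < #|` F|%:R :> R by rewrite ltr0n cardfs_gt0.
pose D f := iter f S @^-1` A.
have mD f : measurable (D f).
  by rewrite /D -[X in measurable X]setTI; exact: measurable_iter.
have nuD f : nu (D f) = nu A.
  by elim: f => // f IH; rewrite -IH -(pS (D f)) // /D; congr (nu _);
    apply/funext => y; rewrite /preimage /= -iterSr.
pose visits y : R := \sum_(f <- F) \1_(D f) y.
have visitsE y : visits y = (count (fun f => `[< A (iter f S y) >]) F)%:R.
  rewrite /visits -sum1_count natr_sum [RHS]big_mkcond /=.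
  apply: eq_bigr => f _; rewrite indicE; case: asboolP => AS.
    by rewrite mem_set.
  by rewrite memNset.
have mvisits : measurable_fun setT visits.
  by apply: measurable_sum => f; exact: measurable_indic.
pose B := visits @^-1` [set x | a / 2 * #|` F|%:R < x].
have mB : measurable B.
  rewrite /B -[X in measurable X]setTI; apply: mvisits => //.
  have -> : [set x | a / 2 * #|` F|%:R < x] = `]a / 2 * #|` F|%:R, +oo[%classic.
    by apply/seteqP; split => x /=; rewrite in_itv /= andbT.
  exact: measurable_itv.
exists B; split => //; last by move=> y /= /ltW; rewrite visitsE.
have a2 : 0 <= a / 2 * #|` F|%:R by apply: mulr_ge0; [lra|exact: ltW].
have := @sum_measure_le _ _ _ nu F D (~` B) _ mD (measurableC mB) a2 _.
have noB y : (~` B) y -> \sum_(f <- F) \1_(D f) y <= a / 2 * #|` F|%:R.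
  by rewrite leNgt => nB; apply/negP.
move=> /(_ noB); rewrite setCK.
have -> : \sum_(f <- F) fine (nu (D f)) = #|` F|%:R * fine (nu A).
  under eq_bigr do rewrite nuD.
  by rewrite big_const_seq count_predT iter_addr addr0 mulr_natl.
have := ler_wpM2l (ltW Fpos) aA.
by move=> aF sumD; rewrite -(ler_pM2l Fpos); lra.
Qed.

(** The bound on [M] gives [(r ^ M) ^ 2 <= q], so that [N * r ^ M] is of smaller
    order than [q]. *)
Lemma logarithmic_cover_bound (R : realType) (r M N q : nat) (a : R) :
  (0 < r)%N -> 0 < a ->
  M%:R <= (2 * (ln r%:R + 1))^-1 * ln q%:R :> R ->
  (4 * N%:R / a) ^+ 2 < q%:R ->
  (N * r ^ M)%:R + a / 4 * q%:R < a / 2 * q%:R :> R.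
Proof.
move=> r0 a0 Mq qbig.
have q0 : 0 < q%:R :> R by apply: le_lt_trans qbig; exact: sqr_ge0.
have lnr0 : 0 <= ln r%:R :> R by rewrite ln_ge0 // ler1n.
have lnq0 : 0 <= ln q%:R :> R by rewrite ln_ge0 // ler1n -(ltr0n R).
pose s : R := (r ^ M)%:R.
have s0 : 0 < s by rewrite ltr0n expn_gt0 r0.
have sq : s ^+ 2 <= q%:R.
  rewrite -ler_ln ?posrE ?exprn_gt0 // lnXn // /s natrX lnXn ?ltr0n //.
  rewrite -[leLHS]mulr_natr -[_ *+ M]mulr_natr.
  have lr1 : 0 < 2 * (ln r%:R + 1) :> R by lra.
  have : M%:R * (2 * (ln r%:R + 1)) <= ln q%:R :> R.
    by rewrite -ler_pdivlMr // mulrC.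
  have : 0 <= M%:R :> R by [].
  move=> M0 le; apply: le_trans le; lra.
have N0 : 0 <= N%:R :> R by [].
rewrite natrM -/s.
suff : N%:R * s < a / 4 * q%:R by move=> lt; lra.
have [sN|Ns] := lerP s (4 * N%:R / a).
  have NE : N%:R = a / 4 * (4 * N%:R / a) by field; apply: lt0r_neq0.
  rewrite {1}NE -mulrA ltr_pM2l; last by lra.
  apply: le_lt_trans qbig; rewrite expr2 ler_wpM2l //.
  by apply: divr_ge0; [lra|exact: ltW].
apply: (@lt_le_trans _ _ (a / 4 * s ^+ 2)).
  rewrite expr2 mulrA ltr_pM2r //.
  by move: Ns; rewrite ltr_pdivrMr // => Ns; lra.
by rewrite ler_pM2l //; lra.
Qed.

(** * From vanishing slow entropy to rigidity *)

Lemma rel_slow_entropy_lt (R : realType) d (X : measurableType d) (T : X -> X)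
    d' (Y : measurableType d') (nu : set Y -> \bar R)
    (mu_ : Y -> set X -> \bar R) (F : nat -> {fset nat}) (r : nat)
    (P : X -> 'I_r) (eps eta : R) :
  rel_slow_entropy T nu mu_ (fun n => ln n%:R) F = 0%E ->
  measurable_partition P -> 0 < eps -> 0 < eta ->
  \forall n \near \oo, (1 < #|` F n|)%N ->
    (rel_cov T nu mu_ P (F n) eps < (eta * ln #|` F n|%:R)%:E)%E.
Proof.
move=> entropy0 mP eps0 eta0.
have : (limn_esup (fun n => rel_cov T nu mu_ P (F n) eps /
    (ln #|` F n|%:R)%:E) < eta%:E)%E.
  apply: (@le_lt_trans _ _ 0%E); last by rewrite lte_fin.
  by rewrite -entropy0; apply: ereal_sup_ubound; exists r, P, eps.
move=> /ereal_inf_lt [_ [V Voo <-] Vlt]; apply: filterS Voo => n Vn F1.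
have lnF : 0 < ln #|` F n|%:R :> R by rewrite ln_gt0 // ltr1n.
rewrite EFinM -lte_pdivrMr // -[X in (_ * X%:E)%E]/((ln _)^-1).
apply: le_lt_trans Vlt; apply: ereal_sup_ubound; exists n => //.
by rewrite inver gt_eqF.
Qed.

Lemma rel_cov_lt (R : realType) d (X : measurableType d) (T : X -> X)
    d' (Y : measurableType d') (nu : set Y -> \bar R)
    (mu_ : Y -> set X -> \bar R) (r : nat)
    (P : X -> 'I_r) (F : {fset nat}) (eps c : R) :
  (rel_cov T nu mu_ P F eps < c%:E)%E ->
  exists S' : set Y, [/\ measurable S', ((1 - eps)%:E <= nu S')%E &
    forall y, S' y -> exists (M : nat) (E : 'I_M -> set X),
      [/\ M%:R < c, forall i, measurable (E i),
          forall i, (hamming_diam R T P F (E i) <= eps%:E)%E &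
          ((1 - eps)%:E <= mu_ y (\bigcup_i E i))%E]].
Proof.
move=> /ereal_inf_lt [_ [S' [mS' nuS'] <-] supS']; exists S'; split => // y S'y.
have : (cov T (mu_ y) P F eps < c%:E)%E.
  by apply: le_lt_trans supS'; apply: ereal_sup_ubound; exists y.
move=> /ereal_inf_lt [_ [M [E [mE diamE EU]] <-]]; rewrite lte_fin => Mc.
by exists M, E.
Qed.

(** If the set has measure [a > 0], fix [eps] so small that the error term of
    [fibre_cover_lower_bound] is at most half of the number of visits guaranteed
    by [frequent_visits]. A set of measure [1 - eps] meets the set of points with
    frequent visits; in the fibre of such a point, covers are of logarithmic size
    at least. *)
Lemma nonrecurrent_null (R : realType) d (Y : measurableType d)
    (nu : probability Y R) (S : Y -> Y) (alpha : Y -> Aut R)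
    (T : Y * I01 R -> Y * I01 R) (F : nat -> {fset nat}) (k N : nat) :
  measure_preserving nu S -> skew_product S alpha T -> folner R F ->
  rel_slow_entropy T nu (@fibre_measure R d Y) (fun n => ln n%:R) F = 0%E ->
  nu (nonrecurrent T k N) = 0%E.
Proof.
move=> mpS skew folF entropy0; have mT := skew.1.
set A := nonrecurrent T k N.
have mA : measurable A by exact: measurable_nonrecurrent.
have nuA : nu A = (fine (nu A))%:E by rewrite fineK // fin_num_measure.
set a := fine (nu A) in nuA.
have a0 : 0 <= a by rewrite fine_ge0.
move: a0; rewrite le_eqVlt => /predU1P [a0|a0]; first by rewrite nuA -a0.
exfalso.
pose r := #|{: {ffun 'I_k -> bool}}|.
have r0 : (0 < r)%N by apply/card_gt0P; exists [ffun=> true].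
(* [4 * eps * k.+1 = a / 4] bounds the proportion of poorly approximated times,
   and [eps < a / 2] makes the two sets of points meet. *)
pose eps : R := a / (16 * k.+1%:R).
have k0 : 0 < k.+1%:R :> R by rewrite ltr0n.
have k1 : 1 <= k.+1%:R :> R by rewrite ler1n.
have eps0 : 0 < eps by rewrite divr_gt0 // mulr_gt0.
have epsE : 16 * eps * k.+1%:R = a.
  by rewrite /eps; field; rewrite gt_eqF.
(* With this [eta], a cover of size [eta * ln q] has [r ^ M <= q ^ (1/2)]. *)
pose eta : R := (2 * (ln r%:R + 1))^-1.
have lnr0 : 0 <= ln r%:R :> R by rewrite ln_ge0 // ler1n.
have eta0 : 0 < eta by rewrite invr_gt0; lra.
have mP : measurable_partition (fun z : Y * I01 R => ray_code k z.2).
  exact: (@measurable_iter_code _ _ _ T k 0).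
pose C := Num.bound ((4 * N.+1%:R / a) ^+ 2 : R).
have [n [covn Cn F1]] : exists n, [/\ ((1 < #|` F n|)%N ->
      (rel_cov T nu (@fibre_measure R d Y) (fun z => ray_code k z.2) (F n) eps <
       (eta * ln #|` F n|%:R)%:E)%E), (C < #|` F n|)%N & (1 < #|` F n|)%N].
  apply: (@filter_ex _ \oo).
  near=> n; split; near: n; [|exact: folner_card_gt folF..].
  exact: rel_slow_entropy_lt.
have F0 : F n != fset0 by rewrite -cardfs_gt0; apply: ltn_trans F1.
have [S' [mS' nuS' covS']] := rel_cov_lt (covn F1).
have [B [mB nuB Bvisits]] := frequent_visits mpS mA F0 (ltW a0) (lexx a).
have [y [S'y By]] : exists y, S' y /\ B y.
  apply: contrapT => nSB.
  have : (nu S' <= nu (~` B))%E.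
    apply: le_measure; rewrite ?inE //; first exact: measurableC.
    by move=> y S'y By; apply: nSB; exists y.
  move=> /(le_trans nuS'); rewrite probability_setC //.
  have -> : nu B = (fine (nu B))%:E by rewrite fineK // fin_num_measure.
  rewrite -EFinB lee_fin => le.
  have : eps <= eps * k.+1%:R by rewrite ler_peMr // ltW.
  lra.
have [M [E [Mlt mE diamE EU]]] := covS' y S'y.
have upper := fibre_cover_lower_bound N skew F0 (ltW eps0) mE diamE EU.
have lower := Bvisits y By.
have := @logarithmic_cover_bound R r M N.+1 #|` F n| a r0 a0 (ltW Mlt).
have qbig : (4 * N.+1%:R / a) ^+ 2 < #|` F n|%:R.
  apply: lt_le_trans (_ : C%:R <= _); last by rewrite ler_nat ltnW.
  by apply: archi_boundP; exact: sqr_ge0.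
move=> /(_ qbig); apply/negP; rewrite -leNgt.
apply: le_trans lower _; apply: le_trans upper _.
by rewrite lerD2l ler_wpM2r // invrK; lra.
Unshelve. all: by end_near.
Qed.

(** The [k]-th return time is chosen, after the previous one, for the [k]-th
    partition and the tolerance [1 / (k + 1)]; as the partitions become finer,
    each ray is controlled by all but finitely many of these choices. *)
Lemma recurrent_rigid (R : realType) d (Y : measurableType d) (S : Y -> Y)
    (alpha : Y -> Aut R) (T : Y * I01 R -> Y * I01 R) (y : Y) :
  skew_product S alpha T -> (forall k N, ~ nonrecurrent T k N y) ->
  exists n_ : nat -> nat, {homo n_ : i j / (i < j)%N} /\
    (fun k => cocycle_iter S alpha (n_ k) y) @ \oo --> aut_id R.
Proof.
move=> skew rec.
have /choice [next nextP] : forall kN : nat * nat, exists n,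
    (kN.2 <= n)%N /\ (drift T kN.1 n y < kN.1.+1%:R^-1%:E)%E.
  move=> [k N]; apply: contrapT => none; apply: (rec k N) => n Nn.
  by rewrite leNgt; apply/negP => lt; apply: none; exists n.
pose n_ := fix n_ k := if k is k'.+1 then next (k, (n_ k').+1) else next (0%N, 0%N).
have n_drift k : (drift T k (n_ k) y < k.+1%:R^-1%:E)%E.
  by case: k => [|k]; [exact: (nextP (0%N, 0%N)).2|exact: (nextP (k.+1, _)).2].
exists n_; split.
  apply: homo_ltn => [j i k|k]; first exact: ltn_trans.
  exact: (nextP (k.+1, (n_ k).+1)).1.
apply: aut_cvg_rat_rays => i.
have inv_cvg : (k.+1%:R^-1%:E : \bar R) @[k --> \oo] --> 0%E.
  apply: cvg_EFin; first by apply: nearW.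
  exact: cvg_harmonic.
apply: (squeeze_cvge _ (cvg_cst 0%E) inv_cvg).
exists i.+1 => // k /= ik; rewrite measure_ge0 /=.
exact: le_trans (aut_dist_rat_ray_le_drift _ _ skew ik) (ltW (n_drift k)).
Qed.

Theorem theorem4p10 (R : realType) (d : measure_display)
    (Y : measurableType d) (nu : probability Y R) (S : Y -> Y)
    (alpha : Y -> Aut R) (T : Y * I01 R -> Y * I01 R)
    (hY : standard_borel R Y) (hS : invertible_mp nu S) (hE : ergodic nu S)
    (halpha : cocycle alpha) (hT : skew_product S alpha T) :
  (exists F : nat -> {fset nat},
    folner R F /\
    rel_slow_entropy T nu (@fibre_measure R d Y) (fun n => ln n%:R) F = 0%E) ->
  rigid_extension S nu alpha.
Proof.
move=> [F [folF entropy0]].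
have null : nu.-negligible (\bigcup_k \bigcup_N nonrecurrent T k N).
  apply: negligible_bigcup => k; apply: negligible_bigcup => N.
  exists (nonrecurrent T k N); split => //.
    exact: measurable_nonrecurrent hT.1.
  exact: nonrecurrent_null hS.1 hT folF entropy0.
apply: negligibleS null => y /= notrigid; apply: contrapT => nU.
apply: notrigid; apply: (recurrent_rigid hT) => k N yN.
by apply: nU; exists k => //; exists N.
Qed.
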